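(* Let $M$ be a finite set of positive integers. Then $M$ is an admissible mesa set if and only if $$|M \cap [1,x]| \le \frac{2x-1}{3}$$ for all $x \in M$.
   Context: For a positive integer $n$, write $[n]=\{1,\dots,n\}$. A Stirling permutation of order $n$ is a word $w = w(1)w(2)\cdots w(2n)$ consisting of the multiset of letters $\{1,1,\ldots,n,n\}$ (each value of $[n]$ appears exactly twice), such that for each $1\le k\le n$, all of the values appearing between the two copies of $k$ in $w$ are larger than $k$. $Q_n$ denotes the set of Stirling permutations of order $n$. For $w\in Q_n$, if there is an index $i\in\{2,\ldots,2n-2\}$ such that $w(i-1)<w(i)=w(i+1)>w(i+2)$, then the value $w(i)$ is called a mesa of $w$. $\mathrm{Mesa}(w)\subseteq[n]$ denotes the set of all mesas of $w$. A set $M$ is an admissible mesa set if there exist a positive integer $n$ and a Stirling permutation $w\in Q_n$ with $\mathrm{Mesa}(w)=M$. Here $[1,x]=\{1,2,\dots,x\}$. *)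

(* Defs.v *)
From mathcomp Require Import all_boot all_order all_algebra.
From mathcomp Require Import finmap.

Set Implicit Arguments.
Unset Strict Implicit.
Unset Printing Implicit Defensive.

Import Order.TTheory GRing.Theory Num.Theory.

Local Open Scope nat_scope.
Local Open Scope fset_scope.

(* w(i), with positions numbered from 1; only used for 1 <= i <= size w. *)
Definition letter (w : seq nat) (i : nat) : nat := nth 0 w i.-1.

Definition double_multiset (n : nat) : seq nat :=
  flatten [seq [:: k; k] | k <- iota 1 n].

(* Each k in [n] occurs exactly twice in w, so the two positions i < l with
   w(i) = w(l) = k are the two copies of k. *)
Definition stirling (n : nat) (w : seq nat) : Prop :=
  perm_eq w (double_multiset n) /\
  (forall k i j l : nat,
     1 <= k <= n -> 1 <= i -> i < j -> j < l -> l <= 2 * n ->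
     letter w i = k -> letter w l = k -> k < letter w j).

Definition mesa_at (w : seq nat) (i : nat) : bool :=
  [&& letter w i.-1 < letter w i,
      letter w i == letter w i.+1 &
      letter w i.+2 < letter w i.+1].

(* index_iota 2 (2 * n - 1) enumerates 2, ..., 2n - 2 (nothing if n = 1). *)
Definition Mesa (n : nat) (w : seq nat) : {fset nat} :=
  [fset letter w i | i in index_iota 2 (2 * n - 1) & mesa_at w i].

Definition admissible_mesa_set (M : {fset nat}) : Prop :=
  exists (n : nat) (w : seq nat), 0 < n /\ stirling n w /\ Mesa n w = M.

(* Main.v *)
Require Import Defs.
From mathcomp Require Import all_boot all_order all_algebra.
From mathcomp Require Import finmap.
From mathcomp Require Import zify.

(** Over the naturals the inequality reads [3 * c < 2 * x], where [c] is the
    number of elements of [M] that are at most [x].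

    Necessity is a count of positions.  Let [x] be a mesa of [w].  A mesa at
    position [i] that is at most [x] makes the letters in the three positions
    [i], [i.+1], [i.+2] at most [x], and triples of different mesas are
    disjoint, since a plateau cannot be both above and below its neighbour.
    The position just before the first of these mesas also carries a letter
    below [x] and lies in no triple.  So [w] has at least [3 * c + 1] letters
    that are at most [x], while the multiset provides [2 * x] of them
    ([mesa_bound]).

    Sufficiency packs such triples with one letter between plateaus.  List
    the elements of [M] as [t_0 < t_1 < ...] and the other elements of [[n]] as
    [a_0 < a_1 < ...], and push the doubled mesas into the successive gaps of
    [a_0 a_0 a_1 a_1 ...]:
    [[
      a_0 t_0 t_0 a_0 t_1 t_1 a_1 t_2 t_2 a_1 t_3 t_3 a_2 ...
    ]]
    until the mesas are used up; the remaining [a]'s follow in increasing order.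
    The right neighbour of [t_j] is [a_(floor ((j + 1) / 2))], and the
    inequality at [x = t_j] says exactly that more than [(j + 1) / 2] non-mesas
    are smaller than [t_j], so that this neighbour is smaller than [t_j]; this
    is the relation [fits].  Once it holds, the word is a Stirling permutation
    ([interleave_nested]) and its mesas are precisely the [t_j]
    ([mesa_at_interleave] and [mesa_interleave_mem]). *)

Set Implicit Arguments.
Unset Strict Implicit.
Unset Printing Implicit Defensive.

Import Order.TTheory GRing.Theory Num.Theory.

(** * Sorted sequences and doubled words *)

Lemma sorted_ltn_uniq (s : seq nat) : sorted ltn s -> uniq s.
Proof. by rewrite ltn_sorted_uniq_leq => /andP[]. Qed.

Lemma sorted_ltn_nth_leq (s : seq nat) i j :
  sorted ltn s -> i <= j -> j < size s -> nth 0 s i <= nth 0 s j.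
Proof.
move=> sorted_s le_ij lt_j; rewrite (@sorted_leq_nth _ leq) ?inE //.
- exact: leq_trans.
- by apply: sub_sorted sorted_s => x y /ltnW.
- exact: leq_ltn_trans lt_j.
Qed.

Lemma sorted_ltn_nth_inj (s : seq nat) i j :
  sorted ltn s -> i < size s -> j < size s -> nth 0 s i = nth 0 s j -> i = j.
Proof.
move=> /sorted_ltn_uniq uniq_s lt_i lt_j E.
by apply/eqP; rewrite -(nth_uniq 0 lt_i lt_j uniq_s) E.
Qed.

Lemma count_leq_iota x n : count (fun y => y <= x) (iota 1 n) = minn x n.
Proof.
elim: n => [|n IH]; first by rewrite minn0.
by rewrite -[n.+1]addn1 iotaD count_cat IH /=; lia.
Qed.

(** [double_multiset n] is by definition [doubled (iota 1 n)]. *)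
Definition doubled (s : seq nat) : seq nat := flatten [seq [:: k; k] | k <- s].

Lemma size_doubled s : size (doubled s) = 2 * size s.
Proof. by elim: s => //= x s ->; rewrite mulnS. Qed.

Lemma nth_doubled s q : nth 0 (doubled s) q = nth 0 s q./2.
Proof. by elim: s q => [|x s IH] [|[|q]] //=; rewrite ?nth_nil ?IH. Qed.

Lemma perm_doubled s1 s2 : perm_eq s1 s2 -> perm_eq (doubled s1) (doubled s2).
Proof. by move=> ?; apply/perm_flatten/perm_map. Qed.

Lemma count_doubled (p : pred nat) s : count p (doubled s) = 2 * count p s.
Proof. by elim: s => //= x s ->; lia. Qed.

(** * Necessity: disjoint triples of positions *)

(** The positions [i], [i.+1], [i.+2] over all mesas at most [x], together with
    the one before the first of them, are distinct and carry letters at most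
    [x]. *)
Lemma mesa_bound w x :
  let I := [seq i <- index_iota 2 (size w).-1 | mesa_at w i & letter w i <= x] in
  0 < size I -> 3 * size I < count (fun y => y <= x) w.
Proof.
set r := index_iota _ _ => I.
have memI i : i \in I ->
    [/\ 1 < i < (size w).-1, letter w i.-1 < letter w i,
        letter w i = letter w i.+1, letter w i.+2 < letter w i.+1 & letter w i <= x].
  by rewrite mem_filter mem_index_iota => /andP[/andP[/and3P[? /eqP ? ?] ?] ?].
have sI : sorted ltn I.
  by apply: sorted_filter; [exact: ltn_trans | exact: iota_ltn_sorted].
have uI := sorted_ltn_uniq sI.
case EI: I => [//|i0 I0] _; rewrite -EI.
have minI i : i \in I -> i0 <= i.
  rewrite EI inE => /predU1P[-> //|hi]; apply: ltnW.
  by move: sI; rewrite EI => /(order_path_min ltn_trans)/allP/(_ _ hi).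
have I_i0 : i0 \in I by rewrite EI mem_head.
pose P := [seq p <- iota 1 (size w) | letter w p <= x].
have <- : size P = count (fun y => y <= x) w.
  rewrite size_filter -[in RHS](mkseq_nth 0 w) /mkseq count_map.
  by rewrite -[1]/(1 + 0) iotaDl count_map.
pose T := i0.-1 :: I ++ map succn I ++ map (succn \o succn) I.
have -> : (3 * size I).+1 = size T by rewrite /T /= !size_cat !size_map; lia.
have inP p : p \in P = (letter w p <= x) && (0 < p <= size w).
  by rewrite mem_filter mem_iota add1n ltnS.
apply: uniq_leq_size => [|p].
  rewrite /T cons_uniq !cat_uniq uI !map_inj_uniq //; last 2 first.
  - by move=> ? ? [].
  - by move=> ? ? [].
  rewrite /= uI /= !andbT; apply/and3P; split.
  - rewrite !mem_cat !negb_or; have [hi0 _ _ _ _] := memI _ I_i0.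
    by apply/and3P; split; [|apply/mapP => -[i]|apply/mapP => -[i /=]];
       [apply/negP| |] => /minI; lia.
  - rewrite has_cat negb_or; apply/andP; split; apply/hasPn => _ /mapP[i hi ->];
      apply/negP => hi'; have [] := memI _ hi; have [] := memI _ hi' => /=; lia.
  - apply/hasPn => _ /mapP[i hi ->]; apply/mapP => -[i' hi' /= [E]].
    by have [] := memI _ hi; have [] := memI _ hi'; rewrite E; lia.
rewrite !inE !mem_cat inP => /predU1P[->|/or3P[hi|/mapP[i hi ->]|/mapP[i hi ->]]].
- by have [] := memI _ I_i0; lia.
- by have [] := memI _ hi; lia.
- by have [] := memI _ hi; lia.
- by have [] := memI _ hi => /=; lia.
Qed.

Lemma stirling_mesa_card n w x :
  stirling n w -> x \in Mesa n w ->
  3 * #|` [fset y in Mesa n w | (1 <= y <= x)%N]%fset | < 2 * x.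
Proof.
move=> [pw _] Mx.
have size_w : size w = 2 * n.
  by rewrite (perm_size pw) -/(doubled _) size_doubled size_iota.
pose I := [seq i <- index_iota 2 (size w).-1 | mesa_at w i & letter w i <= x].
have le_c : #|` [fset y in Mesa n w | (1 <= y <= x)%N]%fset | <= size I.
  rewrite -(size_map (letter w)); apply: uniq_leq_size => [|y]; first exact: fset_uniq.
  rewrite !inE => /andP[/imfsetP[i /= + ->] /andP[_ le_x]].
  rewrite inE => /andP[hi mi]; apply: map_f.
  by rewrite mem_filter mi le_x size_w -subn1.
have c_gt0 : 0 < #|` [fset y in Mesa n w | (1 <= y <= x)%N]%fset |.
  rewrite cardfs_gt0; apply/fset0Pn; exists x; rewrite !inE Mx leqnn andbT.
  by case/imfsetP: Mx => i /=; rewrite inE => /andP[_ /and3P[h _ _]] ->; lia.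
have := mesa_bound (leq_trans c_gt0 le_c).
rewrite (permP pw) -/(doubled _) count_doubled count_leq_iota.
by rewrite -/I in le_c *; lia.
Qed.

(** * Interleaving a word with doubled letters *)

(** [s_0 t_0 t_0 s_1 t_1 t_1 ...], followed by the rest of [s] when [t] runs
    out.  It is used only when [size t <= size s]. *)
Fixpoint interleave (s t : seq nat) : seq nat :=
  if t is m :: t' then [:: head 0 s, m, m & interleave (behead s) t'] else s.

Lemma perm_interleave s t :
  size t <= size s -> perm_eq (interleave s t) (s ++ doubled t).
Proof.
elim: t s => [|m t IH] [|x s] // le_ts; rewrite ?cats0 // [interleave _ _]/= cat_cons.
rewrite perm_cons perm_sym -[doubled (m :: t)]/([:: m; m] ++ doubled t) perm_catCA /=.
by rewrite !perm_cons perm_sym IH.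
Qed.

(** Where the letter [q] of [s] ends up in [interleave s t] when [size t = c]:
    two letters are inserted after each of the first [c] letters. *)
Definition base_pos c q := q + 2 * minn q c.

Lemma nth_interleave_base s t q :
  size t <= size s ->
  nth 0 (interleave s t) (base_pos (size t) q) = nth 0 s q.
Proof.
rewrite /base_pos; elim: t s q => [|m t IH] s q; first by rewrite minn0 muln0 addn0.
case: s q => [|x s] [|q] // le_ts.
have -> : q.+1 + 2 * minn q.+1 (size (m :: t)) = (q + 2 * minn q (size t)).+3.
  by rewrite /=; lia.
by rewrite /= IH.
Qed.

Lemma nth_interleave_insert s t j e :
  j < size t -> 0 < e <= 2 -> nth 0 (interleave s t) (3 * j + e) = nth 0 t j.
Proof.
move=> lt_jt he; elim: t s j lt_jt => [|m t IH] s [|j] // lt_jt.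
  by case: e he {IH} => [|[|[|]]].
have -> : 3 * j.+1 + e = (3 * j + e).+3 by lia.
by rewrite /= IH.
Qed.

Lemma pos_cases c p :
  (exists q, p = base_pos c q) \/
  (exists j e, [/\ p = 3 * j + e, j < c & 0 < e <= 2]).
Proof.
rewrite /base_pos; case: (ltnP p (3 * c)) => hp; last by left; exists (p - 2 * c); lia.
have := divn_eq p 3; have := ltn_pmod p (isT : 0 < 3) => lt_r eq_p.
case: (posnP (p %% 3)) => hr; first by left; exists (p %/ 3); lia.
by right; exists (p %/ 3), (p %% 3); split; lia.
Qed.

(** * The mesas of an interleaved word *)

(** In [interleave (doubled a) t] the letters around the plateau of [t_j] are
    the entries [j] and [j.+1] of [doubled a]; [fits] asks the larger one, which
    is the right one for increasing [a], to exist and to be below [t_j]. *)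
Definition fits (a t : seq nat) : Prop := forall j, j < size t ->
  j.+1./2 < size a /\ nth 0 a j.+1./2 < nth 0 t j.

Lemma fits_size a t : fits a t -> size t <= 2 * size a.
Proof.
move=> fit; case E: (size t) => [//|c].
by have [] := fit c; rewrite ?E //; lia.
Qed.

Lemma size_interleave a t :
  fits a t -> size (interleave (doubled a) t) = 2 * (size a + size t).
Proof.
move=> /fits_size le_ta.
by rewrite (perm_size (perm_interleave _)) ?size_cat ?size_doubled //; lia.
Qed.

Lemma nth_interleave_doubled a t q :
  fits a t ->
  nth 0 (interleave (doubled a) t) (base_pos (size t) q) = nth 0 a q./2.
Proof.
by move=> /fits_size le_ta; rewrite nth_interleave_base ?nth_doubled ?size_doubled.
Qed.

(** The two copies of [t_j] are adjacent, and the two copies of a letter of [a]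
    enclose at most the plateau of one [t_j], which is larger by [fits]. *)
Lemma interleave_nested a t (w := interleave (doubled a) t) i j l :
  sorted ltn a -> sorted ltn t -> (forall x : nat, x \in a -> x \notin t) ->
  fits a t -> i < j -> j < l -> l < size w ->
  nth 0 w i = nth 0 w l -> nth 0 w i < nth 0 w j.
Proof.
move=> sorted_a sorted_t disjoint_at fit; rewrite /w size_interleave // => lt_ij lt_jl lt_l.
have le_ta := fits_size fit.
have neq_at q m : q < size a -> m < size t -> nth 0 a q <> nth 0 t m.
  by move=> hq hm E; have := disjoint_at _ (mem_nth 0 hq); rewrite E mem_nth.
case: (pos_cases (size t) i) => [[q ei]|[m [e [ei lt_m he]]]];
  case: (pos_cases (size t) l) => [[q' el]|[m' [e' [el lt_m' he']]]];
  rewrite ei el ?nth_interleave_doubled ?nth_interleave_insert // => E;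
  rewrite /base_pos in ei el.
- have hq : q./2 = q'./2 by apply: sorted_ltn_nth_inj sorted_a _ _ E; lia.
  (* Hence [q' = q.+1], and the letters strictly between are inserted ones. *)
  case: (pos_cases (size t) j) => [[r ej]|[r [f [ej lt_r hf]]]].
    by rewrite /base_pos in ej; lia.
  have -> : q./2 = r./2 by congr half; lia.
  rewrite ej nth_interleave_insert //; have [h1 h2] := fit _ lt_r.
  by apply: leq_ltn_trans h2; apply: sorted_ltn_nth_leq => //; lia.
- by case: (neq_at q./2 m') => //; lia.
- by case: (neq_at q'./2 m) => //; lia.
- have eq_m := sorted_ltn_nth_inj sorted_t lt_m lt_m' E.
  by lia.
Qed.

Lemma mesa_at_interleave a t j :
  sorted ltn a -> fits a t -> j < size t ->
  mesa_at (interleave (doubled a) t) (3 * j + 2).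
Proof.
move=> sorted_a fit lt_j; have [h1 h2] := fit _ lt_j; rewrite /mesa_at /letter.
have -> : (3 * j + 2).-1.-1 = base_pos (size t) j by rewrite /base_pos; lia.
have -> : (3 * j + 2).+2.-1 = base_pos (size t) j.+1 by rewrite /base_pos; lia.
have -> : (3 * j + 2).-1 = 3 * j + 1 by lia.
rewrite !nth_interleave_doubled // !nth_interleave_insert // eqxx h2 /= andbT.
by apply: leq_ltn_trans h2; apply: sorted_ltn_nth_leq => //; lia.
Qed.

(** A letter of [a] preceded by an inserted one sits below it, and a letter in
    the final increasing part is not followed by a descent. *)
Lemma mesa_interleave_mem a t (w := interleave (doubled a) t) i :
  sorted ltn a -> fits a t -> 1 < i -> i.+2 <= size w -> mesa_at w i ->
  letter w i \in t.
Proof.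
move=> sorted_a fit; rewrite /w size_interleave // => lt1i le_i /and3P[].
rewrite /letter; have le_ta := fits_size fit.
case: (pos_cases (size t) i.-1) => [[q ei]|[m [e [ei lt_m he]]]]; last first.
  by rewrite ei nth_interleave_insert // mem_nth.
rewrite ei nth_interleave_doubled //; rewrite /base_pos in ei.
case: (leqP q (size t)) => hq.
  have lt_q : q.-1 < size t by lia.
  have -> : (base_pos (size t) q).-1 = 3 * q.-1 + 2 by rewrite /base_pos; lia.
  rewrite nth_interleave_insert //; have [_] := fit _ lt_q.
  have -> : q.-1.+1 = q by lia.
  by lia.
have -> : i.+1.-1 = base_pos (size t) q.+1 by rewrite /base_pos; lia.
have -> : i.+2.-1 = base_pos (size t) q.+2 by rewrite /base_pos; lia.
rewrite !nth_interleave_doubled // => _ _.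
by rewrite ltnNge sorted_ltn_nth_leq //; lia.
Qed.

(** * Sufficiency *)

(** If [k] values of [[n]] up to [m = t_j] are mesas, then [m - k] are not.
    Here [k = j.+1], and the inequality at [m] turns [m - k] into a bound that
    exceeds [j.+1./2]. *)
Lemma fits_of_card n (M : {fset nat}) :
  (forall x : nat, x \in M -> 0 < x <= n) ->
  (forall x : nat, x \in M -> 3 * #|` [fset y in M | (1 <= y <= x)%N]%fset | < 2 * x) ->
  fits [seq k <- iota 1 n | k \notin M] [seq k <- iota 1 n | k \in M].
Proof.
set a : seq nat := filter _ _; set t : seq nat := filter _ _.
move=> M_n bound j lt_j; set m := nth 0 t j.
have sorted_filter_iota (p : pred nat) : sorted ltn (filter p (iota 1 n)).
  by apply: sorted_filter; [exact: ltn_trans | exact: iota_ltn_sorted].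
have sorted_t : sorted ltn t := sorted_filter_iota _.
have sorted_a : sorted ltn a := sorted_filter_iota _.
have Mm : m \in M by have := mem_nth 0 lt_j; rewrite mem_filter => /andP[].
have count_t : count (fun y => y <= m) t = j.+1 by apply: count_le_nth.
have card_m : #|` [fset y in M | (1 <= y <= m)%N]%fset | = j.+1.
  rewrite -count_t -size_filter; apply/perm_size/uniq_perm; first exact: fset_uniq.
    by apply/filter_uniq/sorted_ltn_uniq.
  move=> y; rewrite !inE !mem_filter mem_iota add1n ltnS -[y \in mem_fin _]/(y \in M).
  case My: (y \in M); rewrite /= ?andbF //.
  by have [y_gt0 le_yn] := andP (M_n _ My); rewrite y_gt0 le_yn !andbT.
have count_a : j.+1./2 < count (fun y => y <= m) a.
  have /permP/(_ (fun y => y <= m)) : perm_eq (t ++ a) (iota 1 n).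
    by apply/permPl/perm_filterC.
  have /andP[_ le_mn] := M_n _ Mm.
  rewrite count_cat count_leq_iota (minn_idPl le_mn) count_t.
  by have := bound _ Mm; rewrite card_m; move: (count _ a) => ca; lia.
have lt_a : j.+1./2 < size a by apply: leq_trans count_a (count_size _ _).
split=> //; rewrite ltn_neqAle; apply/andP; split.
  apply: contraTneq Mm => <-.
  by have := mem_nth 0 lt_a; rewrite mem_filter => /andP[].
apply: (@nth_count_le _ nat m 0 a) => //.
by apply: sub_sorted sorted_a => x y /ltnW.
Qed.

Lemma admissible_of_card (M : {fset nat}) :
  (forall x : nat, x \in M -> 0 < x) ->
  (forall x : nat, x \in M -> 3 * #|` [fset y in M | (1 <= y <= x)%N]%fset | < 2 * x) ->
  admissible_mesa_set M.
Proof.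
move=> M_gt0 bound.
(* Any positive bound on the elements of [M] will do as the order. *)
pose n := (\max_(m <- M) m).+1.
have M_n m : m \in M -> 0 < m <= n.
  by move=> Mm; rewrite M_gt0 //=; apply/leqW/leq_bigmax_seq.
have fit := fits_of_card M_n bound.
set a : seq nat := filter _ _ in fit; set t : seq nat := filter _ _ in fit.
have sorted_filter_iota (p : pred nat) : sorted ltn (filter p (iota 1 n)).
  by apply: sorted_filter; [exact: ltn_trans | exact: iota_ltn_sorted].
have sorted_t : sorted ltn t := sorted_filter_iota _.
have sorted_a : sorted ltn a := sorted_filter_iota _.
have mem_t x : (x \in t) = (x \in M).
  rewrite mem_filter mem_iota add1n ltnS.
  by case Mx: (x \in M) => //=; rewrite M_n.
have disjoint_at x : x \in a -> x \notin t by rewrite mem_filter mem_t => /andP[].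
have perm_ta : perm_eq (t ++ a) (iota 1 n) by apply/permPl/perm_filterC.
have size_ta : size a + size t = n.
  by rewrite -(size_iota 1 n) -(perm_size perm_ta) size_cat addnC.
have size_w := size_interleave fit; rewrite size_ta in size_w.
have le_ta := fits_size fit.
exists n, (interleave (doubled a) t); split=> //; split.
  split=> [|k i j l _ hi lt_ij lt_jl hl <- /esym E].
    rewrite (perm_trans (perm_interleave _)) ?size_doubled //.
    have -> : doubled a ++ doubled t = doubled (a ++ t).
      by rewrite /doubled map_cat flatten_cat.
    rewrite -[double_multiset n]/(doubled (iota 1 n)).
    by apply: perm_doubled; rewrite perm_catC.
  by apply: (interleave_nested sorted_a sorted_t disjoint_at fit _ _ _ E); lia.
apply/fsetP => x; apply/imfsetP/idP => /= [[i]|].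
  rewrite inE mem_index_iota => /andP[hi mi] ->.
  by rewrite -mem_t (mesa_interleave_mem sorted_a fit) //; lia.
rewrite -mem_t => /(nthP 0)[j lt_jt <-]; exists (3 * j + 2).
  rewrite inE mem_index_iota (mesa_at_interleave sorted_a fit) // andbT.
  have lt_j : j < size t := lt_jt.
  by have [lt_a _] := fit _ lt_j; lia.
rewrite /letter -(nth_interleave_insert (doubled a) lt_jt (isT : 0 < 1 <= 2)).
by congr nth; lia.
Qed.

Lemma rat_bound_nat (c x : nat) :
  ((c%:R : rat) <= (2%:R * x%:R - 1) / 3%:R)%R = (3 * c < 2 * x).
Proof. by rewrite ler_pdivlMr ?ltr0n // lerBrDr -!natrM natr1 ler_nat mulnC. Qed.

Theorem theorem3p2 (M : {fset nat}) (hM : forall x : nat, x \in M -> (0 < x)%N) :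
  admissible_mesa_set M <->
  (forall x : nat, x \in M ->
     ((#|` [fset y in M | (1 <= y <= x)%N]%fset |%:R : rat)
        <= (2%:R * x%:R - 1) / 3%:R)%R).
Proof.
split=> [[n [w [_ [st_w <-]]]] x Mx|bound]; first by rewrite rat_bound_nat stirling_mesa_card.
by apply: admissible_of_card => // x /bound; rewrite rat_bound_nat.
Qed.
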